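(* Fix a variable $x \in \mathsf{Var}$. For every formula $\phi(x) \in \Pi^{x} \cup \Sigma^{x}$, the fixed-point equation $x \equiv \phi(x)$ has a solution, i.e., there exists a formula $\lambda \in \mathscr{L}_{x}$ (a formula in which $x$ does not occur) such that for every model $M=(W,\mathcal{R},V)$ and every $w \in W$: $M,w \models \lambda$ if and only if $M,w \models \phi(\lambda)$, where $\phi(\lambda)$ is obtained from $\phi(x)$ by replacing every occurrence of $x$ by $\lambda$.
   Context: Syntax. Let $\mathsf{Prop}$ be a countable set of propositional atoms, $\mathsf{Var}$ a countable set of variables (disjoint from $\mathsf{Prop}$), and $\mathsf{Prog}$ a countable set of atomic programs. Formulae $\mathscr{L}$ and programs are generated simultaneously by $\phi ::= x \mid p \mid \neg p \mid \phi \lor \phi \mid \phi \land \phi \mid \langle \alpha \rangle \phi \mid [\alpha]\phi$ and $\alpha ::= a \mid \phi? \mid \alpha;\alpha \mid \alpha \cup \alpha \mid \alpha^{*}$, with $x \in \mathsf{Var}$, $p \in \mathsf{Prop}$, $a \in \mathsf{Prog}$. $\mathsf{Var}(\phi)$ and $\mathsf{Var}(\alpha)$ denote the sets of variables occurring in $\phi$, resp. in $\alpha$ (including inside tests). $\mathscr{L}_{x} := \{\phi \in \mathscr{L} \mid x \notin \mathsf{Var}(\phi)\}$. Syntactic negation $\overline{\phi}$: $\overline{p} := \neg p$, $\overline{\neg p} := p$, $\overline{y} := y$ for $y \in \mathsf{Var}$ (variables are left unchanged), $\overline{\phi \lor \psi} := \overline{\phi} \land \overline{\psi}$, $\overline{\phi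 \land \psi} := \overline{\phi} \lor \overline{\psi}$, $\overline{\langle\alpha\rangle\phi} := [\alpha]\overline{\phi}$, $\overline{[\alpha]\phi} := \langle\alpha\rangle\overline{\phi}$. Semantics. A model is $M=(W,\mathcal{R},V)$ with $W$ a nonempty set, $\mathcal{R} = \{R_a \subseteq W\times W \mid a \in \mathsf{Prog}\}$, and $V : \mathsf{Prop}\cup\mathsf{Var} \to 2^{W}$. Relations for complex programs: $R_{\phi?} := \{(w,w) \mid M,w\models\phi\}$, $R_{\alpha;\beta} := R_\alpha \circ R_\beta$ (first $R_\alpha$ then $R_\beta$), $R_{\alpha\cup\beta} := R_\alpha \cup R_\beta$, $R_{\alpha^*} :=$ reflexive-transitive closure of $R_\alpha$. Satisfaction: $M,w\models A$ iff $w \in V(A)$ for $A \in \mathsf{Prop}\cup\mathsf{Var}$; $M,w\models\neg p$ iff $w\notin V(p)$; $\lor,\land$ as usual; $M,w\models\langle\alpha\rangle\phi$ iff some $u$ with $(w,u)\in R_\alpha$ has $M,u\models\phi$; $M,w\models[\alpha]\phi$ iff all $u$ with $(w,u)\in R_\alpha$ have $M,u\models\phi$. Hierarchies. $\Pi^{x}_{0} := \{\phi \lor (\psi \land x) \mid \phi,\psi \in \mathscr{L}_{x}\}$; for $n \in \mathbb{N}$, $\Pi^{x}_{2n+1} := \{[\alpha]\phi \mid \phi \in \Pi^{x}_{2n},\ x \notin \mathsf{Var}(\alpha)\}$ and $\Pi^{x}_{2n+2} := \{\phi \lor (\psi \land \chi) \mid \chi \in \Pi^{x}_{2n+1},\ \phi,\psi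 \in \mathscr{L}_{x}\}$; $\Pi^{x} := \bigcup_{n\in\mathbb{N}} \Pi^{x}_{n}$. Dually, $\Sigma^{x} := \{\overline{\phi} \mid \phi \in \Pi^{x}\}$. *)

(* Defs.v *)
From Stdlib Require Import Relation_Operators.
From mathcomp Require Import all_boot.

Set Implicit Arguments.
Unset Strict Implicit.
Unset Printing Implicit Defensive.

(* Keeping the atoms [P], the variables [V] and the atomic programs [A] as
   separate type parameters makes atoms and variables disjoint. *)
Inductive form (P V A : Type) : Type :=
| FVar of V
| FAtom of P
| FNAtom of P
| FOr of form P V A & form P V A
| FAnd of form P V A & form P V A
| FDia of prog P V A & form P V A
| FBox of prog P V A & form P V A
with prog (P V A : Type) : Type :=
| PAtom of A
| PTest of form P V A
| PSeq of prog P V A & prog P V A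
| PCup of prog P V A & prog P V A
| PStar of prog P V A.

Arguments FVar {P V A}.
Arguments FAtom {P V A}.
Arguments FNAtom {P V A}.
Arguments FOr {P V A}.
Arguments FAnd {P V A}.
Arguments FDia {P V A}.
Arguments FBox {P V A}.
Arguments PAtom {P V A}.
Arguments PTest {P V A}.
Arguments PSeq {P V A}.
Arguments PCup {P V A}.
Arguments PStar {P V A}.

(* The sets Var(phi) and Var(alpha), as sequences up to order and repetition. *)
Fixpoint fvars (P V A : Type) (f : form P V A) {struct f} : seq V :=
  match f with
  | FVar y => [:: y]
  | FAtom _ | FNAtom _ => [::]
  | FOr g h | FAnd g h => fvars g ++ fvars h
  | FDia a g | FBox a g => pvars a ++ fvars g
  end
with pvars (P V A : Type) (a : prog P V A) {struct a} : seq V :=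
  match a with
  | PAtom _ => [::]
  | PTest f => fvars f
  | PSeq b c | PCup b c => pvars b ++ pvars c
  | PStar b => pvars b
  end.

Definition free_of (P A : Type) (V : eqType) (x : V) (f : form P V A) : Prop :=
  x \notin fvars f.

(* Variables, and programs together with the tests inside them, are left
   unchanged. *)
Fixpoint fneg (P V A : Type) (f : form P V A) : form P V A :=
  match f with
  | FVar y => FVar y
  | FAtom p => FNAtom p
  | FNAtom p => FAtom p
  | FOr g h => FAnd (fneg g) (fneg h)
  | FAnd g h => FOr (fneg g) (fneg h)
  | FDia a g => FBox a (fneg g)
  | FBox a g => FDia a (fneg g)
  end.

(* Replacement of every occurrence of [x] by [l], inside tests too. *)
Fixpoint fsubst (P A : Type) (V : eqType) (x : V) (l f : form P V A) {struct f} :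
    form P V A :=
  match f with
  | FVar y => if y == x then l else FVar y
  | FAtom p => FAtom p
  | FNAtom p => FNAtom p
  | FOr g h => FOr (fsubst x l g) (fsubst x l h)
  | FAnd g h => FAnd (fsubst x l g) (fsubst x l h)
  | FDia a g => FDia (psubst x l a) (fsubst x l g)
  | FBox a g => FBox (psubst x l a) (fsubst x l g)
  end
with psubst (P A : Type) (V : eqType) (x : V) (l : form P V A) (a : prog P V A)
    {struct a} : prog P V A :=
  match a with
  | PAtom b => PAtom b
  | PTest f => PTest (fsubst x l f)
  | PSeq b c => PSeq (psubst x l b) (psubst x l c)
  | PCup b c => PCup (psubst x l b) (psubst x l c)
  | PStar b => PStar (psubst x l b)
  end.

Record model (P V A : Type) : Type := Model {
  world : Type;
  world_nonempty : inhabited world;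
  acc : A -> world -> world -> Prop;
  valuation : P + V -> world -> Prop
}.

Fixpoint sat (P V A : Type) (M : model P V A) (w : world M) (f : form P V A)
    {struct f} : Prop :=
  match f with
  | FVar y => valuation (inr y) w
  | FAtom p => valuation (inl p) w
  | FNAtom p => ~ valuation (inl p) w
  | FOr g h => sat w g \/ sat w h
  | FAnd g h => sat w g /\ sat w h
  | FDia a g => exists u, prel a w u /\ sat u g
  | FBox a g => forall u, prel a w u -> sat u g
  end
with prel (P V A : Type) (M : model P V A) (a : prog P V A) (w u : world M)
    {struct a} : Prop :=
  match a with
  | PAtom b => acc b w u
  | PTest f => w = u /\ sat w f
  | PSeq b c => exists v, prel b w v /\ prel c v u
  | PCup b c => prel b w u \/ prel c w u
  | PStar b => clos_refl_trans (world M) (fun v v' => prel b v v') w u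
  end.

Inductive Pi_level (P A : Type) (V : eqType) (x : V) :
    nat -> form P V A -> Prop :=
| Pi_zero f g :
    free_of x f -> free_of x g ->
    Pi_level x 0 (FOr f (FAnd g (FVar x)))
| Pi_odd n a f :
    Pi_level x (2 * n) f -> x \notin pvars a ->
    Pi_level x (2 * n + 1) (FBox a f)
| Pi_even n f g h :
    Pi_level x (2 * n + 1) h -> free_of x f -> free_of x g ->
    Pi_level x (2 * n + 2) (FOr f (FAnd g h)).

Definition Pi_class (P A : Type) (V : eqType) (x : V) (f : form P V A) : Prop :=
  exists n, Pi_level x n f.

Definition Sigma_class (P A : Type) (V : eqType) (x : V) (f : form P V A) :
    Prop :=
  exists g, Pi_class x g /\ f = fneg g.

(* Main.v *)
(** A [Sigma] formula is equivalent to [c \/ <a>x] for some [c] and [a] free of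
    [x], because [f /\ (g \/ x)] is [(f /\ g) \/ <f?>x]; hence [<a*>c] solves
    its equation.

    Dually one would like to write a [Pi] formula as [c /\ [a]x] with solution
    [[a*]c], reading [f \/ (g /\ x)] as [(f \/ g) /\ [~f?]x].  But [~f] is not
    expressible when [f] contains variables and there are no atoms, since then
    falsity is not expressible either.  So [~f] is relativised to [f -> b], that
    is [[f?]b], where [b := [u*]c] and the program [u] covers all the steps made
    by [a].  Such a [b] is preserved along [a] and entails the solution, so the
    additional worlds let through by the test are harmless. *)
Require Import Defs.
From Stdlib Require Import Classical_Prop Relation_Operators Operators_Properties.
From mathcomp Require Import all_boot.

Set Implicit Arguments.
Unset Strict Implicit.
Unset Printing Implicit Defensive.

Scheme form_prog_ind := Induction for form Sort Prop
  with prog_form_ind := Induction for prog Sort Prop.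

Combined Scheme form_prog_mutind from form_prog_ind, prog_form_ind.

(** Tests put formulas inside programs, hence the mutual induction. It lets a substitution pass over
    the coefficients and programs of a [Pi] or [Sigma] formula. *)
Lemma subst_id (P A : Type) (V : eqType) (x : V) (l : form P V A) :
  (forall f : form P V A, free_of x f -> fsubst x l f = f) /\
  (forall a : prog P V A, x \notin pvars a -> psubst x l a = a).
Proof.
rewrite /free_of; apply: form_prog_mutind => //=.
- by move=> y; rewrite inE eq_sym => /negbTE ->.
- by move=> g IHg h IHh; rewrite mem_cat => /norP[/IHg-> /IHh->].
- by move=> g IHg h IHh; rewrite mem_cat => /norP[/IHg-> /IHh->].
- by move=> a IHa g IHg; rewrite mem_cat => /norP[/IHa-> /IHg->].
- by move=> a IHa g IHg; rewrite mem_cat => /norP[/IHa-> /IHg->].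
- by move=> g IHg /IHg->.
- by move=> a IHa b IHb; rewrite mem_cat => /norP[/IHa-> /IHb->].
- by move=> a IHa b IHb; rewrite mem_cat => /norP[/IHa-> /IHb->].
- by move=> a IHa /IHa->.
Qed.

Lemma fvars_fneg (P V A : Type) (f : form P V A) : fvars (fneg f) = fvars f.
Proof. by elim: f => //= [g -> h -> | g -> h -> | a g -> | a g ->]. Qed.

Lemma prel_star (P V A : Type) (M : model P V A) (a : prog P V A)
    (w u : world M) :
  prel (PStar a) w u <->
  w = u \/ exists v, prel a w v /\ prel (PStar a) v u.
Proof.
split=> [wu | [<- | [v [wv vu]]]].
- have {wu} := clos_rt_rt1n _ _ _ _ wu; elim=> [y | y v z yv _ H]; first by left.
  right; exists v; split=> //.
  case: H => [<- | [t [vt tz]]]; first exact: rt_refl.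
  by apply: (rt_trans _ _ _ t) => //; exact: rt_step.
- exact: rt_refl.
- by apply: (rt_trans _ _ _ v) => //; exact: rt_step.
Qed.

(** Splitting off the first iteration shows that [[a*]c] solves [x = c /\ [a]x], the shape to which
    [Pi] equations are reduced. *)
Lemma sat_box_star (P V A : Type) (M : model P V A) (a : prog P V A)
    (c : form P V A) (w : world M) :
  sat w (FBox (PStar a) c) <->
  sat w c /\ forall v, prel a w v -> sat v (FBox (PStar a) c).
Proof.
split=> [H | [wc H] u /prel_star[<- // | [v [wv vu]]]]; last exact: H vu.
split=> [|v wv u vu]; apply/H/prel_star; first by left.
by right; exists v.
Qed.

Lemma sat_dia_star (P V A : Type) (M : model P V A) (a : prog P V A)
    (c : form P V A) (w : world M) :
  sat w (FDia (PStar a) c) <->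
  sat w c \/ exists v, prel a w v /\ sat v (FDia (PStar a) c).
Proof.
split=> [[u [/prel_star[<- | [v [wv vu]]] uc]] | [wc | [v [wv [u [vu uc]]]]]].
- by left.
- by right; exists v; split=> //; exists u.
- by exists w; split=> //; apply/prel_star; left.
- by exists u; split=> //; apply/prel_star; right; exists v.
Qed.

Lemma star_closed (P V A : Type) (M : model P V A) (a : prog P V A)
    (Q : world M -> Prop) :
  (forall w v, prel a w v -> Q w -> Q v) ->
  forall w v, prel (PStar a) w v -> Q w -> Q v.
Proof. by move=> H w v /=; elim=> [y z /H // | // | y t z _ IH1 _ IH2 /IH1]. Qed.

Lemma star_sub (P V A : Type) (M : model P V A) (a u : prog P V A) :
  (forall w v : world M, prel a w v -> prel (PStar u) w v) ->
  forall w v : world M, prel (PStar a) w v -> prel (PStar u) w v.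
Proof.
move=> H w v /=; elim=> [y z /H // | y | y z t _ yz _ zt]; first exact: rt_refl.
exact: rt_trans yz zt.
Qed.

(** By induction on the level. Only [a] depends on [b]: once [c] and [u] are known for the whole
    formula, [b] can be chosen as [[u*]c] without circularity. *)
Lemma Pi_normal_form (P A : Type) (V : eqType) (x : V) (n : nat)
    (phi : form P V A) :
  Pi_level x n phi ->
  exists (c : form P V A) (u : prog P V A) (a : form P V A -> prog P V A),
    [/\ free_of x c, x \notin pvars u,
        forall b, free_of x b -> x \notin pvars (a b),
        forall b (M : model P V A) (w v : world M),
          prel (a b) w v -> prel (PStar u) w v
      & forall b l (M : model P V A),
          (forall w v : world M, prel u w v -> sat w b -> sat v b) ->
          (forall w : world M, sat w b -> sat w l) ->
          forall w : world M, sat w (fsubst x l phi) <->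
            sat w c /\ forall v, prel (a b) w v -> sat v l].
Proof.
rewrite /free_of.
elim=> {n phi} [f g xf xg | n a f _ [c [u [a' [xc xu xa' a'u H]]]] xa
               | n f g h _ [c [u [a [xc xu xa au H]]]] xf xg].
- exists (FOr f g), (PTest f), (fun b => PTest (FBox (PTest f) b)).
  split=> //=.
  + by rewrite mem_cat negb_or xf.
  + by move=> b xb; rewrite mem_cat negb_or xf.
  + by move=> b M w v [<- _]; exact: rt_refl.
  + move=> b l M _ bl w; rewrite eqxx !(proj1 (subst_id x l)) //.
    split=> [[wf | [wg wl]] | [wfg H]].
    * by split; [left | move=> _ [<- fb]; apply/bl/fb].
    * by split; [right | move=> _ [<- _]].
    (* Where [f] fails, [[f?]b] holds vacuously, so the test is passed and yields [l]. *)
    * case: (classic (sat w f)) => wf; [by left | right].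
      by split; [case: wfg | apply: H; split=> // y [_ /wf]].
(* From [[a](c /\ [a' b]x)] to [[a]c /\ [a; a' b]x]; joining [a] to [u] keeps the new first step
   covered by the iteration. *)
- exists (FBox a c), (PCup a u), (fun b => PSeq a (a' b)).
  have uu' (M : model P V A) (w v : world M) :
    prel (PStar u) w v -> prel (PStar (PCup a u)) w v.
    by apply: star_sub => y z yz; apply: rt_step; right.
  split=> /=.
  + by rewrite mem_cat negb_or xa.
  + by rewrite mem_cat negb_or xa.
  + by move=> b xb; rewrite mem_cat negb_or xa xa'.
  + move=> b M w v [y [wy /a'u /uu' yv]].
    by apply: (rt_trans _ _ _ y) => //; apply: rt_step; left.
  + move=> b l M ub bl w; rewrite (proj2 (subst_id x l)) //.
    have {}H y := H b l M (fun w v wv => ub w v (or_intror wv)) bl y.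
    split=> [W | [W1 W2] v wv].
    * split=> [v /W /H[] // | v [y [/W /H[_ Wy] /Wy]] //].
    * by apply/H; split=> [|y vy]; [exact: W1 | apply: W2; exists v].
(* This reads [f \/ (g /\ c /\ [a b]x)] as [(f \/ (g /\ c)) /\ [~f?; a b]x], with [[f?]b] in place
   of [~f]. *)
- exists (FOr f (FAnd g c)), u, (fun b => PSeq (PTest (FBox (PTest f) b)) (a b)).
  split=> //=.
  + by rewrite !mem_cat !negb_or xf xg.
  + by move=> b xb; rewrite !mem_cat !negb_or xf xb xa.
  + by move=> b M w v [y [[<- _]]]; exact: au.
  + move=> b l M ub bl w; rewrite (proj1 (subst_id x l) f xf) (proj1 (subst_id x l) g xg).
    have {}H := H b l M ub bl.
    split=> [[wf | [wg /H[wc W]]] | [wfgc W]].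
    * split; [by left | move=> v [_ [[<- fb] wv]]].
      (* As [f] holds at [w], the test gives [b] there; [b] is carried along [u*], hence to [v],
         where it entails [l]. *)
      by apply/bl; apply: (star_closed ub (au _ _ _ _ wv)); exact: fb.
    * by split; [right | move=> v [_ [[<- _] wv]]; exact: W].
    * case: (classic (sat w f)) => wf; [by left | right].
      case: wfgc => // -[wg wc]; split=> //; apply/H; split=> // v wv.
      by apply: W; exists w; do 2!split=> //; move=> y [_ /wf].
Qed.

(** Here [x] is guarded by [fneg f] itself, a formula already at hand, so the program depends on no
    auxiliary [b]. The argument uses only the syntactic shape of [fneg phi], never that [fneg] is a
    semantic negation. *)
Lemma Sigma_normal_form (P A : Type) (V : eqType) (x : V) (n : nat)
    (phi : form P V A) :
  Pi_level x n phi ->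
  exists (c : form P V A) (a : prog P V A),
    [/\ free_of x c, x \notin pvars a
      & forall l (M : model P V A) (w : world M),
          sat w (fsubst x l (fneg phi)) <->
          sat w c \/ exists v, prel a w v /\ sat v l].
Proof.
rewrite /free_of.
elim=> {n phi} [f g xf xg | n a f _ [c [a' [xc xa' H]]] xa
               | n f g h _ [c [a [xc xa H]]] xf xg].
- exists (FAnd (fneg f) (fneg g)), (PTest (fneg f)); split=> /=.
  + by rewrite mem_cat negb_or !fvars_fneg xf.
  + by rewrite fvars_fneg.
  + move=> l M w; rewrite eqxx !(proj1 (subst_id x l)) /free_of ?fvars_fneg //.
    split=> [[wf [wg | wl]] | [[wf wg] | [_ [[<- wf] wl]]]]; auto.
    by right; exists w.
- exists (FDia a c), (PSeq a a'); split=> /=; rewrite ?mem_cat ?negb_or ?xa //.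
  move=> l M w; rewrite (proj2 (subst_id x l)) //.
  split=> [[v [wv /H[vc | [y [vy yl]]]]] | [[v [wv vc]] | [y [[v [wv vy]] yl]]]].
  + by left; exists v.
  + by right; exists y; split=> //; exists v.
  + by exists v; split=> //; apply/H; left.
  + by exists v; split=> //; apply/H; right; exists y.
- exists (FAnd (fneg f) (FOr (fneg g) c)), (PSeq (PTest (fneg f)) a).
  split=> /=; rewrite ?mem_cat ?negb_or ?fvars_fneg ?xf ?xg //.
  move=> l M w; rewrite (proj1 (subst_id x l) (fneg f)) /free_of ?fvars_fneg //.
  rewrite (proj1 (subst_id x l) (fneg g)) /free_of ?fvars_fneg //.
  split=> [[wf [wg | /H[wc | [v [wv vl]]]]]
          | [[wf [wg | wc]] | [v [[_ [[<- wf] wv]] vl]]]]; auto.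
  + by right; exists v; split=> //; exists w.
  + by split=> //; right; apply/H; left.
  + by split=> //; right; apply/H; right; exists v.
Qed.

Theorem theorem1 (P V A : countType) (x : V) (phi : form P V A)
  (Hphi : Pi_class x phi \/ Sigma_class x phi) :
  exists lambda : form P V A,
    free_of x lambda /\
    forall (M : model P V A) (w : world M),
      sat w lambda <-> sat w (fsubst x lambda phi).
Proof.
case: Hphi => [[n /Pi_normal_form[c [u [a [xc xu xa au H]]]]]
              | [psi [[n /Sigma_normal_form[c [a [xc xa H]]]] ->]]].
- set b := FBox (PStar u) c.
  have xb : free_of x b by rewrite /free_of /= mem_cat negb_or xu.
  exists (FBox (PStar (a b)) c); split.
    by rewrite /free_of /= mem_cat negb_or xa.
  move=> M w; apply: iff_trans (sat_box_star _ _ _) _.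
  (* Unfolding [[u*]c] shows that [b] persists along [u]. It entails the solution because every
     iteration of [a b] is a run of [u*]. *)
  apply: iff_sym; apply: (H b) => [{}w v wv /sat_box_star[_] | {}w wb v wv]; first exact.
  exact/wb/(star_sub (au b M)).
- exists (FDia (PStar a) c); split.
    by rewrite /free_of /= mem_cat negb_or xa.
  by move=> M w; apply: iff_trans (sat_dia_star _ _ _) _; exact: iff_sym (H _ _ _).
Qed.
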